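(* Let $K$ be a quasi-metric kernel on $X$, $\sigma\in\mathcal M_+(X)$, $1<p<\infty$, $\frac1p+\frac1q=1$, and for $x\in X$, $a>0$ let $$N(x,a)=\int_a^\infty\frac{|B_t(x)|_\sigma}{t^{1+q}}\,dt .$$ (1) There is a constant $C$ such that for every $x\in X$ and $a>0$, $\mathrm{Cap}\,B_a(x)\le C\,N(x,a)^{-p/q}$. (2) Suppose that there exists a nonzero measure $\mu\in\mathcal M_+(X)$ which is stable with respect to $K$. Then there is a constant $C$ such that for every $x\in X$ and $a>0$, $$C^{-1}N(x,a)^{-p/q}\le\mathrm{Cap}\,B_a(x)\le C\,N(x,a)^{-p/q}.$$ (3) Suppose that there exists a nonzero measure $\mu\in\mathcal M_+(X)$ which is absolutely continuous with respect to $\sigma$ and stable with respect to $K$. Then there is a constant $C$ such that for every $x\in X$ and $a>0$, $$C^{-1}N(x,a)^{-p/q}\le\mathrm{cap}\,B_a(x)\le\mathrm{Cap}\,B_a(x)\le C\,N(x,a)^{-p/q}.$$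
   Context: $X$ is a metric space and $\mathcal M_+(X)$ is the set of positive $\sigma$-finite Borel measures on $X$; $\sigma$ is the underlying measure. $|E|_\mu=\mu(E)$. A quasi-metric kernel is a Borel function $K:X\times X\to(0,\infty]$ that is symmetric and for which there is a constant $\kappa\ge1$ with $\frac1{K(x,y)}\le\kappa\big(\frac1{K(x,z)}+\frac1{K(z,y)}\big)$ for all $x,y,z\in X$. Put $\rho(x,y)=1/K(x,y)$ and $B_a(x)=\{y\in X:\rho(x,y)\le a\}$. For Borel $g\ge0$, $Kg(x)=\int_X K(x,y)g(y)\,d\sigma(y)$. Capacities: $\mathrm{Cap}\,E=\inf\{\int g^p\,d\sigma:\ g\ge0,\ Kg(x)\ge1\text{ for every }x\in E\}$ and $\mathrm{cap}\,E=\inf\{\int g^p\,d\sigma:\ g\ge0,\ Kg\ge\chi_E\ \sigma\text{-a.e.}\}$. Conventions: $\infty^{-p/q}=0$, $0^{-p/q}=\infty$. A Borel measure $\mu$ on $X$ is locally finite if it is finite on every Borel set $B$ with $\sup_{x,y\in B}\rho(x,y)<\infty$. A locally finite Borel measure $\mu$ is stable with respect to $K$ if there are $C>0$ and $\delta>0$ such that for every $x\in X$ and $0<r<R<\infty$, $$|B_{2R}(x)|_\mu\le C\,|B_R(x)|_\mu\quad\text{and}\quad|B_r(x)|_\mu\le C\left(\frac rR\right)^{1+\delta}|B_R(x)|_\mu .$$ *)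

(* Defs.v *)
From HB Require Import structures.
From mathcomp Require Import all_boot all_order all_algebra.
From mathcomp Require Import all_classical all_reals all_analysis.
From mathcomp Require Import measurable_realfun.

Set Implicit Arguments.
Unset Strict Implicit.
Unset Printing Implicit Defensive.

Import Order.TTheory GRing.Theory Num.Theory.
Import numFieldNormedType.Exports.

Local Open Scope classical_set_scope.
Local Open Scope ring_scope.
Local Open Scope ereal_scope.

(* Measurable types are pointed in the library, so metric spaces must be
   nonempty to carry a Borel sigma-algebra. *)
#[short(type="pmetricType")]
HB.structure Definition PointedMetric (R : numDomainType) :=
  { M of Metric R M & Pointed M }.

HB.instance Definition _ (T U : ptopologicalType) := Pointed.on (T * U)%type.

Definition borel (T : ptopologicalType) : Type := g_sigma_algebraType (@open T).
HB.instance Definition _ (T : ptopologicalType) :=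
  Measurable.copy (borel T) (g_sigma_algebraType (@open T)).

Section QuasiMetricKernel.
Context {R : realType} {X : pmetricType R}.
Implicit Types (K : X -> X -> \bar R) (x y : X) (a : R) (E : set X).

(* Extended inverse: rho K x y = 0 when K x y = +oo. *)
Definition rho K x y : \bar R := (K x y)^-1.

(* Borel means measurable for the sigma-algebra generated by the open sets of
   X * X, which contains the product of the Borel sigma-algebras of X, possibly
   strictly if X is not separable. *)
Definition quasi_metric_kernel K : Prop :=
  [/\ measurable_fun [set: borel (X * X)%type]
        (fun z : borel (X * X)%type => K z.1 z.2),
      forall x y, 0 < K x y,
      forall x y, K x y = K y x &
      exists2 kappa : R, (1 <= kappa)%R &
        forall x y z, rho K x y <= kappa%:E * (rho K x z + rho K z y)].

Definition qball K x a : set X := [set y | rho K x y <= a%:E].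

Definition potential K (sigma : {measure set (borel X) -> \bar R})
    (g : borel X -> \bar R) x : \bar R :=
  \int[sigma]_(y in [set: borel X]) (K x y * g y).

Definition borel_ge0 (g : borel X -> \bar R) : Prop :=
  measurable_fun setT g /\ forall x, 0 <= g x.

Definition Cap K (sigma : {measure set (borel X) -> \bar R}) (p : R) E :
    \bar R :=
  ereal_inf [set \int[sigma]_(y in [set: borel X]) (g y `^ p) | g in
    [set g | borel_ge0 g /\ forall x, E x -> 1 <= potential K sigma g x]].

Definition cap K (sigma : {measure set (borel X) -> \bar R}) (p : R) E :
    \bar R :=
  ereal_inf [set \int[sigma]_(y in [set: borel X]) (g y `^ p) | g in
    [set g | borel_ge0 g /\
      {ae sigma, forall x, (\1_E x)%:E <= potential K sigma g x}]].

Definition locally_finite K (mu : {measure set (borel X) -> \bar R}) : Prop :=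
  forall B : set (borel X), measurable B ->
    ereal_sup [set rho K z.1 z.2 | z in B `*` B] < +oo -> mu B < +oo.

Definition stable K (mu : {measure set (borel X) -> \bar R}) : Prop :=
  locally_finite K mu /\
  exists C delta : R, [/\ (0 < C)%R, (0 < delta)%R &
    forall x (r s : R), (0 < r)%R -> (r < s)%R ->
      mu (qball K x (2 * s)%R) <= C%:E * mu (qball K x s) /\
      mu (qball K x r) <=
        (C * (r / s) `^ (1 + delta))%R%:E * mu (qball K x s)].

Definition Nint K (sigma : {measure set (borel X) -> \bar R}) (q : R) x a :
    \bar R :=
  \int[lebesgue_measure]_(t in `[a, +oo[)
    (sigma (qball K x t) / (t `^ (1 + q))%R%:E).

(* N(x,a)^(-p/q). It is written as an inverse because the library's power
   sends +oo to +oo and 0 to 0 also for negative exponents; the extended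
   inverse gives +oo^(-p/q) = 0 and 0^(-p/q) = +oo. *)
Definition Npow K (sigma : {measure set (borel X) -> \bar R}) (p q : R) x a :
    \bar R :=
  (Nint K sigma q x a `^ (p / q)%R)^-1.

End QuasiMetricKernel.

(* Main.v *)
Require Import Defs.
From HB Require Import structures.
From mathcomp Require Import all_boot all_order all_algebra.
From mathcomp Require Import all_classical all_reals all_analysis.
From mathcomp Require Import measurable_realfun.
From mathcomp Require Import ring lra.

Import Order.TTheory GRing.Theory Num.Theory.
Import numFieldNormedType.Exports.

Local Open Scope classical_set_scope.
Local Open Scope ring_scope.
Local Open Scope ereal_scope.

(** Write [d] for the quasi-distance [1/K] and [w y = 1/max(a, d x y)], the
    profile of the kernel seen from the ball [B] of radius [a] about [x].
    Integrating [t^(-1-q)] over [t >= max(a, d x y)] and exchanging the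
    integrals gives [q N(x,a) = int w^q dsigma] ([int_qweight]).  The theorem
    says that, for the purpose of capacity, the kernel may be replaced on [B]
    by this one function: minimizing [int g^p] subject to [int g w >= 1] is
    the duality between [L^p] and [L^q], with value [(int w^q)^(-p/q)].

    Upper bound.  On [B] the quasi-triangle inequality gives
    [K z y >= w y / (2 kappa)], so the extremal function [w^(q-1)] of the dual
    problem, suitably scaled, is admissible ([test_function]).  When
    [int w^q] is infinite, one restricts it to sets on which the integral is
    finite but large, and the capacity vanishes.

    Lower bound.  A single point of [B] is useless here, since the kernel is
    unbounded near it; one averages [1 <= K g] over [B] against the stable
    measure [mu].  If [y] is far from [B], then [K z y <= 2 kappa w y] for all
    [z] in [B]; if [y] is close, the growth exponent [1 + delta > 1] makes the
    dyadic sum of the [(2^k/a) mu(B_(2^-k a)(y))] geometric, so that the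
    [mu]-average of [K(., y)] over [B] is at most a constant times [1/a].  Hence
    [1 <= A int g w dsigma] ([averaging]) and Young's inequality concludes
    ([energy_ge]).  Averaging only needs [1 <= K g] to hold [mu]-almost
    everywhere, which is what absolute continuity of [mu] provides for the
    capacity [cap].

    The delicate point is the exchange of integrals in the averaging step.
    The kernel is Borel on [X * X], but it need not be measurable for the
    product sigma-algebra when [X] is not separable, and then Tonelli's theorem
    can fail.  Stability saves the argument: a measure which is doubling for
    [d] forces the balls of [d] to be totally bounded ([finite_net]), so that,
    locally, some finite union of measurable rectangles lies between the sets
    [d z y <= r] and [d z y <= L r], with [L] depending on [kappa] only
    ([rectangle_cover]).  A dyadic series of such indicators is a
    product-measurable majorant of the kernel with the same averages up to a
    constant ([kernel_majorant]).

    All estimates are made for a quasi-metric on a measurable space; the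
    topology only enters at the end. *)

(** * Almost everywhere statements, powers and extended inverses *)

Lemma ae_imply {disp} {T : measurableType disp} {R : realType}
    (mu : {measure set T -> \bar R}) (P Q : T -> Prop) :
  (forall x, P x -> Q x) -> {ae mu, forall x, P x} -> {ae mu, forall x, Q x}.
Proof. by move=> PQ; apply: filterS. Qed.

Lemma ae_dominates {disp} {T : measurableType disp} {R : realType}
    (mu nu : {measure set T -> \bar R}) (P : T -> Prop) :
  mu `<< nu -> {ae nu, forall x, P x} -> {ae mu, forall x, P x}.
Proof.
move=> dom [A [mA A0 PA]]; exists A; split => //; apply: (dom A) => // B mB BA.
by apply: (subset_measure0 _ mA BA A0).
Qed.

Lemma in_setb {T : Type} (b : T -> bool) z : (z \in [set y | b y]) = b z.
Proof. by apply/idP/idP; rewrite inE. Qed.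

Lemma measurable_invr_ge0 {disp} {T : measurableType disp} {R : realType}
    (f : T -> R) :
  measurable_fun setT f -> (forall x, (0 <= f x)%R) ->
  measurable_fun setT (fun x => (f x)^-1)%R.
Proof.
move=> mf f0; rewrite (_ : (fun x => _) = (fun x => f x `^ (-1))%R).
  exact: measurableT_comp (measurable_powR _) mf.
by apply/funext => x; rewrite powR_inv1.
Qed.

Lemma integral_powR_tail {R : realType} (q m : R) :
  (0 < q)%R -> (0 < m)%R ->
  \int[lebesgue_measure]_(t in `[m, +oo[) ((t `^ (1 + q))^-1)%R%:E =
  ((q * m `^ q)^-1)%R%:E.
Proof.
move=> hq hm; pose F (t : R) := (- q^-1 * t `^ (- q))%R.
have dF (t : R) : (0 < t)%R -> is_derive t 1%R F ((t `^ (1 + q))^-1)%R.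
  move=> t0; have h := is_derive1_powR (- q) t0.
  have -> : ((t `^ (1 + q))^-1 = - q^-1 * (- q * t `^ (- q - 1)))%R.
    rewrite mulrA mulrNN mulVf ?gt_eqF// mul1r -powRN.
    by congr (_ `^ _)%R; ring.
  exact: is_deriveZ.
rewrite (@ge0_continuous_FTC2y _ _ F _ 0%R).
- by rewrite /F sub0e -EFinN mulNr opprK powRN invfM.
- by move=> t _; rewrite invr_ge0 powR_ge0.
- apply: continuous_in_subspaceT => t; rewrite inE/= in_itv/= andbT => mt.
  have t0 : (0 < t)%R by apply: lt_le_trans mt.
  rewrite (_ : (fun t => _) = (fun t => t `^ (- (1 + q)))%R); last first.
    by apply/funext => s; rewrite powRN.
  apply: differentiable_continuous; apply/derivable1_diffP.
  by have [] := is_derive1_powR (- (1 + q)) t0.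
- rewrite -(mulr0 (- q^-1)%R); apply: cvgMr.
  apply/cvgrPdist_lt => e e0; near=> t.
  have t0 : (0 < t)%R by [].
  rewrite sub0r normrN ger0_norm ?powR_ge0// powRN -[ltRHS]invrK.
  rewrite ltf_pV2 ?posrE ?invr_gt0 ?powR_gt0//.
  have -> : (e^-1 = (e^-1 `^ q^-1) `^ q)%R.
    by rewrite -powRrM mulVf ?gt_eqF// powRr1// invr_ge0 ltW.
  by apply: gt0_ltr_powR => //; rewrite ?nnegrE ?powR_ge0 ?ltW.
- by move=> t mt; have [] := dF t (lt_trans hm mt).
- apply: cvg_at_right_filter; apply: differentiable_continuous.
  by apply/derivable1_diffP; have [] := dF m hm.
- move=> t; rewrite in_itv/= andbT => mt; rewrite derive1E.
  have h := dF t (lt_trans hm mt); exact: derive_val.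
Unshelve. all: by end_near.
Qed.

(** To bound [I] by [c N^(-s)] it suffices to test against the finite
    positive [M <= N]: this absorbs [N = +oo], where [M] is arbitrarily large,
    and [N = 0], where the bound is vacuous. *)
Lemma le_mul_inve_poweR {R : realType} (N I : \bar R) (c s : R) :
  (0 < c)%R -> (0 < s)%R -> 0 <= N ->
  (forall M : R, (0 < M)%R -> M%:E <= N -> I <= (c * (M `^ s)^-1)%:E) ->
  I <= c%:E * (N `^ s)^-1.
Proof.
move=> c0 s0; case: N => [r| |] //.
- rewrite lee_fin le_eqVlt => /predU1P[<- _|r0 /(_ _ r0 (lexx _))].
    by rewrite poweR0r ?gt_eqF// inve0 gt0_muley ?leey// lte_fin.
  by rewrite poweR_EFin inver gt_eqF ?powR_gt0// -EFinM.
- move=> _ h; rewrite poweRyr ?gt_eqF// invey mule0.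
  apply/lee_addgt0Pr => e e0; rewrite add0e.
  have ce : (0 < c / e)%R by exact: divr_gt0.
  have := h ((c / e) `^ s^-1)%R (powR_gt0 _ ce) (leey _).
  rewrite -powRrM mulVf ?gt_eqF// powRr1 ?(ltW ce)//.
  by rewrite invf_div mulrC divfK ?gt_eqF.
Qed.

Lemma ge_mul_inve_poweR {R : realType} (N I : \bar R) (c s : R) :
  (0 < c)%R -> (0 < s)%R -> 0 <= N -> 0 <= I ->
  (forall M : R, (0 < M)%R -> N <= M%:E -> (c * (M `^ s)^-1)%:E <= I) ->
  c%:E * (N `^ s)^-1 <= I.
Proof.
move=> c0 s0; case: N => [r| |] //.
- rewrite lee_fin le_eqVlt => /predU1P[<- _ h|r0 _ /(_ _ r0 (lexx _))].
    rewrite (_ : I = +oo) ?leey//; apply: eq_infty => t.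
    have [t0|t0] := leP t 0%R.
      apply: (@le_trans _ _ (c * (1 `^ s)^-1)%:E); last exact: h.
      by rewrite lee_fin (le_trans t0)// powR1 invr1 mulr1 ltW.
    have ct : (0 < c / t)%R by exact: divr_gt0.
    have := h ((c / t) `^ s^-1)%R (powR_gt0 _ ct) (powR_ge0 _ _).
    rewrite -powRrM mulVf ?gt_eqF// powRr1 ?(ltW ct)//.
    by rewrite invf_div mulrC divfK ?gt_eqF.
  by rewrite poweR_EFin inver gt_eqF ?powR_gt0// -EFinM.
- by move=> _ I0 _; rewrite poweRyr ?gt_eqF// invey mule0.
Qed.

(** Sigma-finiteness replaces an infinite integral by finite ones that are as
    large as desired. *)
Lemma finite_integral_subset {disp} {T : measurableType disp} {R : realType}
    (sigma : {sigma_finite_measure set T -> \bar R}) (f : T -> R) (c M : R) :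
  measurable_fun setT f -> (forall x, 0 <= f x <= c)%R ->
  M%:E <= \int[sigma]_x (f x)%:E ->
  exists A : set T, [/\ measurable A, M%:E <= \int[sigma]_(x in A) (f x)%:E &
    \int[sigma]_(x in A) (f x)%:E < +oo].
Proof.
move=> mf fc Mf.
have [Wfin|Winf] := ltP (\int[sigma]_x (f x)%:E) +oo; first by exists setT.
have [F UF mF] := sigma_finiteT sigma.
pose G n := \big[setU/set0]_(i < n.+1) F i.
have mG n : measurable (G n).
  by apply: bigsetU_measurable => i _; exact: (mF i).1.
have UG : \bigcup_n G n = setT by rewrite bigcup_bigsetU_bigcup -UF.
have fG n : \int[sigma]_(x in G n) (f x)%:E < +oo.
  have sG : sigma (G n) < +oo.
    rewrite /G; elim: n.+1 => [|m IH]; first by rewrite big_ord0 measure0.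
    rewrite big_ord_recr/=; have [m1 m2] := mF m.
    apply: le_lt_trans (lte_add_pinfty IH m2); apply: measureU2 => //.
    by apply: bigsetU_measurable => i _; exact: (mF i).1.
  apply: (@le_lt_trans _ _ (\int[sigma]_(x in G n) cst c%:E x)).
    apply: ge0_le_integral => //.
    - by move=> x _; rewrite lee_fin; case/andP: (fc x).
    - by apply/measurable_EFinP; exact: measurable_funTS.
    - by move=> x _; rewrite lee_fin; case/andP: (fc x).
  rewrite integral_cst//.
  have c0 : (0 <= c)%R by case/andP: (fc point) => /le_trans; apply.
  by apply: lte_mul_pinfty.
have cv : \int[sigma]_(x in G i) (f x)%:E @[i --> \oo] -->
    \int[sigma]_(x in \bigcup_i G i) (f x)%:E.
  apply: ge0_nondecreasing_set_cvg_integral => //.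
  - by move=> n m nm; apply/subsetPset; exact: subset_bigsetU.
  - by move=> i; apply/measurable_EFinP; exact: measurable_funTS.
  - by move=> i x _; rewrite lee_fin; case/andP: (fc x).
move: cv; rewrite UG.
have -> : \int[sigma]_x (f x)%:E = +oo by apply/eqP; rewrite -leye_eq.
move=> /cvgeyPge/(_ M)[n _ /(_ n (leqnn n))/= Mn].
by exists (G n); split.
Qed.

(** * Quasi-metrics and their kernels *)

(** Only the sections of [d] are assumed measurable, as [d] itself may fail to
    be measurable for the product sigma-algebra. *)
Definition quasi_metric {disp} {T : measurableType disp} {R : realType}
    (d : T -> T -> R) (kappa : R) : Prop :=
  [/\ (1 <= kappa)%R, forall x y, (0 <= d x y)%R, forall x y, d x y = d y x,
      forall x y z, (d x y <= kappa * (d x z + d z y))%R &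
      forall x, measurable_fun setT (d x)].

Definition dball {T : Type} {R : realType} (d : T -> T -> R) x a : set T :=
  [set y | (d x y <= a)%R].

Definition qkernel {T : Type} {R : realType} (d : T -> T -> R) x y : \bar R :=
  ((d x y)%:E)^-1.

(** The power [w^q] of the profile [w y = 1 / max(a, d x y)]. *)
Definition qweight {T : Type} {R : realType} (d : T -> T -> R) (q : R) x a y
    : R :=
  ((Num.max a (d x y)) `^ q)^-1%R.

Definition tail_int {disp} {T : measurableType disp} {R : realType}
    (d : T -> T -> R) (sigma : set T -> \bar R) (q : R) x a : \bar R :=
  \int[lebesgue_measure]_(t in `[a, +oo[)
    (sigma (dball d x t) / (t `^ (1 + q))%R%:E).

Section quasi_metric_theory.
Context {disp} {T : measurableType disp} {R : realType}.
Context (d : T -> T -> R) (kappa : R) (qd : quasi_metric d kappa).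

Lemma qm_ge0 x y : (0 <= d x y)%R. Proof. by case: qd. Qed.
Lemma qm_k1 : (1 <= kappa)%R. Proof. by case: qd. Qed.
Lemma qm_k0 : (0 < kappa)%R. Proof. exact: lt_le_trans qm_k1. Qed.
Lemma qm_sym x y : d x y = d y x. Proof. by case: qd. Qed.
Lemma qm_tri x y z : (d x y <= kappa * (d x z + d z y))%R.
Proof. by case: qd. Qed.
Lemma qm_meas x : measurable_fun setT (d x). Proof. by case: qd. Qed.

Lemma measurable_dball x a : measurable (dball d x a).
Proof.
have md := qm_meas; rewrite -[dball d x a]setTI.
exact: measurable_fun_le.
Qed.

Lemma dball_sub x y s t :
  (kappa * (d y x + s) <= t)%R -> dball d x s `<=` dball d y t.
Proof.
move=> h z xz; apply: le_trans h; apply: (le_trans (qm_tri y z x)).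
by rewrite ler_pM2l ?qm_k0// lerD2l.
Qed.

Lemma le_qkernel x y c :
  (0 < c)%R -> (d x y <= c)%R -> (c^-1)%:E <= qkernel d x y.
Proof.
move=> c0 dc; have -> : (c^-1)%:E = c%:E^-1 by rewrite inver gt_eqF.
by rewrite lee_pV2 ?inE ?lee_fin// ?qm_ge0// ltW.
Qed.

Lemma ge_qkernel x y c :
  (0 < c)%R -> (c <= d x y)%R -> qkernel d x y <= (c^-1)%:E.
Proof.
move=> c0 dc; have -> : (c^-1)%:E = c%:E^-1 by rewrite inver gt_eqF.
by rewrite lee_pV2 ?inE ?lee_fin// ?qm_ge0// ltW.
Qed.

Lemma qkernel_ge0 x y : 0 <= qkernel d x y.
Proof. by rewrite inve_ge0 lee_fin qm_ge0. Qed.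

Lemma measurable_qkernel x : measurable_fun setT (qkernel d x).
Proof.
rewrite (_ : qkernel d x =
    fun y => if (d x y <= 0)%R then +oo else ((d x y)^-1)%:E).
  apply: measurable_fun_ifT => //.
    by apply: measurable_fun_ler => //; exact: qm_meas.
  apply/measurable_EFinP; apply: measurable_invr_ge0; first exact: qm_meas.
  exact: qm_ge0.
by apply/funext => y; rewrite /qkernel inver eq_le qm_ge0 andbT.
Qed.

Lemma measurable_max x a : measurable_fun setT (fun y => Num.max a (d x y)).
Proof. by apply: measurable_maxr => //; exact: qm_meas. Qed.

Lemma qweight_ge0 q x a y : (0 <= qweight d q x a y)%R.
Proof. by rewrite invr_ge0 powR_ge0. Qed.

Lemma measurable_qweight q x a : measurable_fun setT (qweight d q x a).
Proof.
apply: measurable_invr_ge0; last by move=> ?; exact: powR_ge0.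
exact: measurableT_comp (measurable_powR _) (measurable_max _ _).
Qed.

Lemma qweight_le q x a y :
  (0 < a)%R -> (0 <= q)%R -> (qweight d q x a y <= (a `^ q)^-1)%R.
Proof.
move=> a0 q0; have m0 : (0 < Num.max a (d x y))%R by rewrite lt_max a0.
rewrite lef_pV2 ?posrE ?powR_gt0//.
by apply: ge0_ler_powR => //; rewrite ?nnegrE ?le_max ?lexx ?(ltW a0)// ltW.
Qed.

(** Layer cake: for fixed [y], integrating [t^(-1-q)] over the [t >= a] with
    [y] in the ball of radius [t] gives [max(a, d x y)^(-q) / q].  Tonelli's
    theorem applies because only one section of [d] is involved. *)
Lemma tail_int_layer_cake (sigma : {sigma_finite_measure set T -> \bar R})
    x a q : (0 < a)%R -> (0 < q)%R ->
  tail_int d sigma q x a =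
  \int[sigma]_y ((q * (Num.max a (d x y)) `^ q)^-1)%R%:E.
Proof.
move=> a0 q0.
pose S := [set z : T * measurableTypeR R | (Num.max a (d x z.1) <= z.2)%R].
have mS : measurable S.
  rewrite -[S]setTI; apply: measurable_fun_le => //=.
  apply: measurable_maxr => //=.
  exact: (measurableT_comp (qm_meas x) (@measurable_fst _ _ _ _)).
pose h (t : R) := (t `^ (1 + q))^-1%R.
have h0 t : (0 <= h t)%R by rewrite invr_ge0 powR_ge0.
have mh : measurable_fun setT h.
  apply: measurable_invr_ge0; first exact: measurable_powR.
  by move=> t; exact: powR_ge0.
pose f (z : T * measurableTypeR R) := (\1_S z * h z.2)%R%:E.
have mf : measurable_fun setT f.
  apply/measurable_EFinP; apply: measurable_funM; first exact: measurable_indic.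
  exact: measurableT_comp.
have f0 z : 0 <= f z by rewrite lee_fin mulr_ge0.
have H := @fubini_tonelli _ _ _ _ _ sigma lebesgue_measure f mf f0.
transitivity (\int[lebesgue_measure]_t \int[sigma]_y f (y, t)).
  rewrite [LHS]integral_mkcond; apply: eq_integral => t _.
  rewrite /patch in_setb in_itv/= andbT.
  case: ifPn => at_.
    have t0 : (0 < t)%R by apply: lt_le_trans at_.
    rewrite /f; under eq_integral do rewrite EFinM muleC /=.
    have mSt : measurable_fun setT
        (fun y => (\1_S (y, t : measurableTypeR R))%:E : \bar R).
      apply/measurable_EFinP; apply: (measurableT_comp (measurable_indic mS)).
      exact: pair2_measurable.
    rewrite (ge0_integralZl _ _ mSt)//= ?lee_fin//.
    rewrite (_ : (fun y => _) = (fun y => (\1_(dball d x t) y)%:E)).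
      rewrite integral_indic// ?setIT; last exact: measurable_dball.
      by rewrite muleC inver gt_eqF ?powR_gt0.
    apply/funext => y; rewrite !indicE; congr ((nat_of_bool _)%:R%:E).
    by rewrite !in_setb/= ge_max at_.
  rewrite integral0_eq// => y _.
  by rewrite /f indicE /S in_setb/= ge_max (negbTE at_)/= mul0r.
rewrite -H; apply: eq_integral => y _.
set m := Num.max a _.
have m0 : (0 < m)%R by rewrite lt_max a0.
rewrite -(integral_powR_tail _ _ q0 m0) [RHS]integral_mkcond.
apply: eq_integral => t _.
rewrite /patch in_setb in_itv/= andbT /f indicE /S in_setb/= -/m.
by case: ifP => _; rewrite ?mul1r ?mul0r.
Qed.

Lemma int_qweight (sigma : {sigma_finite_measure set T -> \bar R}) x a q :
  (0 < a)%R -> (0 < q)%R ->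
  \int[sigma]_y (qweight d q x a y)%:E = q%:E * tail_int d sigma q x a.
Proof.
move=> a0 q0; rewrite tail_int_layer_cake//.
have mq : measurable_fun setT (fun y => (qweight d q x a y)%:E).
  by apply/measurable_EFinP; exact: measurable_qweight.
rewrite -[LHS]mul1e -(divff (lt0r_neq0 q0)) EFinM -muleA; congr (_ * _).
rewrite -ge0_integralZl// ?lee_fin ?invr_ge0 ?(ltW q0)//.
- by apply: eq_integral => y _; rewrite -EFinM /qweight invfM.
- by move=> y _; rewrite lee_fin qweight_ge0.
Qed.

Lemma tail_int_ge0 (sigma : {measure set T -> \bar R}) x a q :
  0 <= tail_int d sigma q x a.
Proof.
apply: integral_ge0 => t _; apply: mule_ge0 => //.
by rewrite inve_ge0 lee_fin powR_ge0.
Qed.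

End quasi_metric_theory.

(** * Energies of admissible functions *)

Lemma conj_gt0 {R : realType} (p q : R) :
  (1 < p)%R -> (p^-1 + q^-1 = 1)%R -> (0 < q)%R.
Proof.
move=> p1 pq; rewrite -invr_gt0.
have -> : (q^-1 = 1 - p^-1)%R by rewrite -pq addrAC subrr add0r.
by rewrite subr_gt0 invf_lt1// (lt_trans _ p1).
Qed.

Section energy.
Context {disp} {T : measurableType disp} {R : realType}.
Context (p q : R) (p1 : (1 < p)%R) (pq : (p^-1 + q^-1 = 1)%R).

Let q0 : (0 < q)%R := conj_gt0 p q p1 pq.

Let p0 : (0 < p)%R. Proof. exact: lt_trans p1. Qed.

(** The function is [2 kappa / M * w^(q-1)] on [A]: the equality case of
    Hoelder's inequality against [w], scaled so that its potential, at least
    [int g w / (2 kappa)] on the ball, is at least 1 there. *)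
Lemma test_function (d : T -> T -> R) (kappa : R)
    (sigma : {measure set T -> \bar R}) x a (A : set T) (M : R) :
  quasi_metric d kappa -> (0 < a)%R -> (0 < M)%R -> measurable A ->
  \int[sigma]_(y in A) (qweight d q x a y)%:E = M%:E ->
  exists g : T -> \bar R, [/\ measurable_fun setT g, forall y, 0 <= g y,
    forall z, dball d x a z -> 1 <= \int[sigma]_y (qkernel d z y * g y) &
    \int[sigma]_y (g y `^ p) = ((2 * kappa) `^ p * (M `^ (p / q))^-1)%:E].
Proof.
move=> qd a0 M0 mA AM.
have k0 := qm_k0 _ _ qd.
have pneq : (p != 0)%R by rewrite gt_eqF.
have qE : (q = p / (p - 1))%R.
  have h : (q^-1 = (p - 1) / p)%R.
    by rewrite mulrBl divff// mul1r -pq addrC addKr.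
  by rewrite -[LHS]invrK h invf_div.
have pm1 : (0 < p - 1)%R by rewrite subr_gt0.
pose l : R := (2 * kappa / M)%R.
have l0 : (0 < l)%R by rewrite divr_gt0 ?mulr_gt0.
pose g y : R := (l * (\1_A y * qweight d (q - 1) x a y))%R.
have g0 y : (0 <= g y)%R.
  apply: mulr_ge0; first exact: ltW.
  by apply: mulr_ge0 => //; exact: qweight_ge0.
have mg : measurable_fun setT g.
  apply: measurable_funM => //; apply: measurable_funM.
    exact: measurable_indic.
  exact: measurable_qweight _ _ qd _ _ _.
have AM' : \int[sigma]_y (\1_A y * qweight d q x a y)%:E = M%:E.
  rewrite -AM [RHS]integral_mkcond; apply: eq_integral => y _.
  by rewrite /patch indicE; case: ifP => _; rewrite ?mul1r ?mul0r.
have mw : measurable_fun setT (fun y => (\1_A y * qweight d q x a y)%:E).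
  apply/measurable_EFinP; apply: measurable_funM; first exact: measurable_indic.
  exact: measurable_qweight _ _ qd _ _ _.
have w0 y : 0 <= (\1_A y * qweight d q x a y)%:E.
  by rewrite lee_fin; apply: mulr_ge0 => //; exact: qweight_ge0.
have max0 y : (0 < Num.max a (d x y))%R by rewrite lt_max a0.
exists (EFin \o g); split.
- exact/measurable_EFinP.
- by move=> y; rewrite lee_fin.
- move=> z xz.
  have -> : 1 = \int[sigma]_y ((M^-1)%:E * (\1_A y * qweight d q x a y)%:E).
    rewrite ge0_integralZl// ?lee_fin ?invr_ge0 ?(ltW M0)// AM' -EFinM.
    by rewrite mulVf// gt_eqF.
  apply: ge0_le_integral => //.
  - by move=> y _; rewrite mule_ge0// lee_fin invr_ge0 ltW.
  - by apply: emeasurable_funM.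
  - apply: emeasurable_funM; last exact/measurable_EFinP.
    exact: measurable_qkernel _ _ qd _.
  move=> y _; set m := Num.max a (d x y).
  have m0 : (0 < m)%R by exact: max0.
  have dzy : (d z y <= 2 * kappa * m)%R.
    rewrite (le_trans (qm_tri _ _ qd z y x))// (mulrC 2%R) -mulrA ler_pM2l//.
    rewrite mulr_natl mulr2n; apply: lerD; rewrite /m le_max ?lexx ?orbT//.
    by rewrite (qm_sym _ _ qd) xz.
  have c0 : (0 < 2 * kappa * m)%R.
    exact: (mulr_gt0 (mulr_gt0 (ltr0Sn _ 1) k0) m0).
  have h := le_qkernel _ _ qd z y _ c0 dzy.
  apply: le_trans (lee_wpmul2r _ h); last by rewrite lee_fin.
  rewrite -!EFinM lee_fin /g/= /qweight -/m.
  have -> : (m `^ q = m * m `^ (q - 1))%R.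
    rewrite -[X in (X * _)%R]powRr1 ?(ltW m0)// -powRD.
      by congr (_ `^ _)%R; ring.
    by rewrite (gt_eqF m0) implybT.
  rewrite le_eqVlt; apply/orP; left; apply/eqP; rewrite /l.
  by field; rewrite ?gt_eqF// ?powR_gt0.
(* Conjugacy reads (q - 1) p = q, so the p-th power of w^(q-1) is w^q. *)
- have -> : (fun y => (EFin \o g) y `^ p) =
      (fun y => (l `^ p)%:E * (\1_A y * qweight d q x a y)%:E).
    apply/funext => y.
    rewrite -[LHS]/((g y)%:E `^ p) poweR_EFin -EFinM /g; congr (_%:E).
    rewrite powRM ?(ltW l0) ?mulr_ge0// ?qweight_ge0//; congr (_ * _)%R.
    rewrite indicE; case: (_ \in _); last by rewrite !mul0r powR0// gt_eqF.
    rewrite !mul1r /qweight -!powRN -powRrM; congr (_ `^ _)%R.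
    by rewrite qE; field; rewrite gt_eqF.
  rewrite ge0_integralZl// ?lee_fin ?powR_ge0// AM' -EFinM; congr (_%:E).
  rewrite /l powRM ?invr_ge0 ?(ltW M0) ?mulr_ge0 ?(ltW k0)// -mulrA.
  congr (_ * _)%R.
  have -> : (p / q = p - 1)%R by rewrite qE; field; rewrite ?gt_eqF.
  rewrite -[(M^-1)%R]powR_inv1 ?(ltW M0)// -powRrM.
  rewrite -[X in (_ * X)%R]powRr1 ?(ltW M0)//.
  rewrite -powRD; last by rewrite (gt_eqF M0) implybT.
  by rewrite -powRN; congr (_ `^ _)%R; ring.
Qed.

Lemma exists_test_function (d : T -> T -> R) (kappa : R)
    (sigma : {sigma_finite_measure set T -> \bar R}) x a (M : R) :
  quasi_metric d kappa -> (0 < a)%R -> (0 < M)%R ->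
  M%:E <= \int[sigma]_y (qweight d q x a y)%:E ->
  exists g : T -> \bar R, [/\ measurable_fun setT g, forall y, 0 <= g y,
    forall z, dball d x a z -> 1 <= \int[sigma]_y (qkernel d z y * g y) &
    \int[sigma]_y (g y `^ p) <= ((2 * kappa) `^ p * (M `^ (p / q))^-1)%:E].
Proof.
move=> qd a0 M0 MW.
have fc y : (0 <= qweight d q x a y <= (a `^ q)^-1)%R.
  by rewrite qweight_ge0 qweight_le// ltW.
have [A [mA MA Afin]] :=
  finite_integral_subset sigma _ _ _ (measurable_qweight _ _ qd q x a) fc MW.
set J := \int[sigma]_(y in A) _ in MA Afin.
have AE : J = (fine J)%:E.
  by rewrite fineK// ge0_fin_numE// (le_trans _ MA)// lee_fin ltW.
move: MA; rewrite AE lee_fin => MM'.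
have M'0 := lt_le_trans M0 MM'.
have [g [mg g0 gK gI]] := test_function _ _ _ _ _ _ _ qd a0 M'0 mA AE.
exists g; split => //; rewrite gI lee_fin ler_wpM2l ?powR_ge0//.
rewrite lef_pV2 ?posrE ?powR_gt0//; apply: ge0_ler_powR;
  rewrite ?nnegrE ?(ltW M0) ?(ltW M'0)//.
by rewrite divr_ge0 ?ltW.
Qed.

(** This is Hoelder's inequality for [int g w].  It is derived from Young's
    inequality because [g] may take the value [+oo]. *)
Lemma energy_ge (sigma : {measure set T -> \bar R}) (g : T -> \bar R)
    (w : T -> R) (A M : R) :
  measurable_fun setT g -> (forall y, 0 <= g y) ->
  measurable_fun setT w -> (forall y, 0 <= w y)%R ->
  (0 < A)%R -> (0 < M)%R -> 1 <= A%:E * \int[sigma]_y (g y * (w y)%:E) ->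
  \int[sigma]_y (w y `^ q)%:E <= M%:E ->
  (p / (2 * A) * ((2 * A / q) `^ (p / q))^-1 * (M `^ (p / q))^-1)%:E
    <= \int[sigma]_y (g y `^ p).
Proof.
move=> mg g0 mw w0 A0 M0 h WM.
(* The scale l is such that the term in w^q of Young's inequality for
   (l g) * (w / l) contributes at most one half after multiplication by A. *)
pose l := ((2 * A * M / q) `^ q^-1)%R.
have B0 : (0 < 2 * A * M / q)%R by rewrite divr_gt0// mulr_gt0// mulr_gt0.
have l0 : (0 < l)%R by exact: powR_gt0.
set I := \int[sigma]_y _.
have I0 : 0 <= I by apply: integral_ge0 => y _; exact: poweR_ge0.
have [Iy|] := eqVneq I +oo; first by rewrite Iy leey.
rewrite -ltey => Ify; have IE : I = (fine I)%:E by rewrite fineK// ge0_fin_numE.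
have mgp : measurable_fun setT (fun y => g y `^ p).
  exact: measurableT_comp (measurable_poweR _) mg.
have mwq : measurable_fun setT (fun y => (w y `^ q)%:E).
  by apply/measurable_EFinP; exact: measurableT_comp (measurable_powR _) mw.
have young : \int[sigma]_y (g y * (w y)%:E) <=
    (l `^ p / p)%:E * I +
    ((l `^ q)^-1 / q)%:E * \int[sigma]_y (w y `^ q)%:E.
  have cp0 : (0 < l `^ p / p)%R by rewrite divr_gt0 ?powR_gt0.
  have cq0 : (0 < (l `^ q)^-1 / q)%R by rewrite divr_gt0 ?invr_gt0 ?powR_gt0.
  rewrite /I -(ge0_integralZl sigma _ mgp)//; first last.
  - by rewrite lee_fin ltW.
  - by move=> y _; exact: poweR_ge0.
  rewrite -(ge0_integralZl sigma _ mwq)//; first last.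
  - by rewrite lee_fin ltW.
  - by move=> y _; rewrite lee_fin powR_ge0.
  rewrite -ge0_integralD//; first last.
  - exact: measurable_funeM.
  - by move=> y _; rewrite -EFinM lee_fin mulr_ge0 ?powR_ge0// ltW.
  - exact: measurable_funeM.
  - by move=> y _; rewrite mule_ge0 ?poweR_ge0// lee_fin ltW.
  apply: ge0_le_integral => //.
  - by move=> y _; rewrite mule_ge0// lee_fin.
  - by apply: emeasurable_funM => //; exact/measurable_EFinP.
  - by apply: emeasurable_funD; exact: measurable_funeM.
  move=> y _; move: (g0 y); case: (g y) => [r| |] //.
  - rewrite lee_fin => r0; rewrite poweR_EFin -!EFinM -EFinD lee_fin.
    have := @conjugate_powR R (l * r)%R (w y / l)%R p q.
    rewrite !powRM ?invr_ge0 ?(ltW l0)// => /(_ _ _ _ _ pq).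
    have -> : (l * r * (w y / l) = r * w y)%R by field; rewrite gt_eqF.
    have -> : (l^-1 `^ q = (l `^ q)^-1)%R.
      by rewrite -[in LHS]powR_inv1 ?(ltW l0)// -powRrM mulN1r powRN.
    move=> H; apply: le_trans (H _ _ _ _) _ => //.
    + by rewrite mulr_ge0// ltW.
    + by rewrite divr_ge0// ltW.
    + rewrite le_eqVlt; apply/orP; left; apply/eqP.
      by field; rewrite ?gt_eqF ?powR_gt0.
  - move=> _; rewrite poweRyr ?gt_eqF// gt0_muley ?lte_fin//.
    by rewrite addye ?leey.
move: h; rewrite IE lee_fin => h.
have : 1 <= A%:E * ((l `^ p / p)%:E * I + ((l `^ q)^-1 / q)%:E * M%:E).
  apply: (le_trans h); apply: lee_wpmul2l; first by rewrite lee_fin ltW.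
  apply: (le_trans young); apply: leeD2l; apply: lee_wpmul2l => //.
  by rewrite lee_fin divr_ge0 ?invr_ge0 ?powR_ge0// ltW.
rewrite IE (_ : _ * _ =
  (A * ((l `^ p / p) * fine I + ((l `^ q)^-1 / q) * M))%R%:E)// lee_fin.
have -> : (l `^ q = 2 * A * M / q)%R.
  by rewrite /l -powRrM mulVf ?gt_eqF// powRr1// ltW.
have -> : (l `^ p = (2 * A / q) `^ (p / q) * M `^ (p / q))%R.
  rewrite /l -powRrM -powRM ?(ltW M0)//; last first.
    by rewrite divr_ge0 ?mulr_ge0 ?(ltW A0) ?(ltW q0).
  by congr (_ `^ _)%R; [field; rewrite gt_eqF|rewrite mulrC].
set u := (_ `^ _)%R; set v := (M `^ _)%R; set J := fine I.
have u0 : (0 < u)%R by rewrite powR_gt0// divr_gt0// mulr_gt0.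
have v0 : (0 < v)%R by rewrite powR_gt0.
rewrite mulrDr.
have -> : (A * ((2 * A * M / q)^-1 / q * M) = 2^-1)%R by field; rewrite !gt_eqF.
move=> H1.
have H2 : (2^-1 <= A * (u * v / p * J))%R by lra.
have -> : (J = (A * (u * v / p * J)) * (p / (A * (u * v))))%R.
  by field; rewrite !gt_eqF.
have -> : (p / (2 * A) / u / v = 2^-1 * (p / (A * (u * v))))%R.
  by field; rewrite !gt_eqF.
by apply: ler_wpM2r => //; rewrite divr_ge0 ?mulr_ge0 ?ltW.
Qed.

End energy.

(** * Doubling measures and product-measurable majorants *)

Section stable_measure.
Context {disp} {T : measurableType disp} {R : realType}.
Context (d : T -> T -> R) (kappa : R) (qd : quasi_metric d kappa).
Context (mu : {sigma_finite_measure set T -> \bar R}) (C delta : R).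
Context (C0 : (0 < C)%R) (delta0 : (0 < delta)%R).
Context (mu_fin : forall x s, mu (dball d x s) < +oo).
Context (mu_dbl : forall x s, (0 < s)%R ->
  mu (dball d x (2 * s)%R) <= C%:E * mu (dball d x s)).
Context (mu_dec : forall x r s, (0 < r)%R -> (r < s)%R ->
  mu (dball d x r) <= (C * (r / s) `^ (1 + delta))%R%:E * mu (dball d x s)).
Context (mu_neq0 : mu setT <> 0).

Let k1 : (1 <= kappa)%R := qm_k1 _ _ qd.
Let k0 : (0 < kappa)%R := qm_k0 _ _ qd.
Let mB x s : measurable (dball d x s) := measurable_dball _ _ qd x s.

Definition vol x s : R := fine (mu (dball d x s)).

Lemma volE x s : mu (dball d x s) = (vol x s)%:E.
Proof. by rewrite fineK// ge0_fin_numE. Qed.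

Lemma le_vol x y s t : dball d x s `<=` dball d y t -> (vol x s <= vol y t)%R.
Proof.
by move=> h; rewrite -lee_fin -!volE; apply: le_measure; rewrite ?inE.
Qed.

Lemma le_vol_radius x s t : (s <= t)%R -> (vol x s <= vol x t)%R.
Proof.
by move=> st; apply: le_vol => z; rewrite /dball/= => /le_trans; apply.
Qed.

Lemma vol_expn n x s : (0 < s)%R -> (vol x (2 ^+ n * s) <= C ^+ n * vol x s)%R.
Proof.
move=> s0; elim: n => [|n IH]; first by rewrite !expr0 !mul1r.
have s1 : (0 < 2 ^+ n * s)%R by rewrite mulr_gt0// exprn_gt0.
have := mu_dbl x _ s1.
rewrite mulrA -exprS !volE -EFinM lee_fin => /le_trans; apply.
by rewrite exprS -mulrA ler_pM2l.
Qed.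

Lemma vol_scale (l : R) : exists2 A : R, (0 < A)%R &
  forall x s, (0 < s)%R -> (vol x (l * s) <= A * vol x s)%R.
Proof.
have h := upper_nthrootP (leqnn (Num.Def.archi_bound l)).
exists (C ^+ (Num.Def.archi_bound l))%R; first exact: exprn_gt0.
move=> x s s0; apply: le_trans (vol_expn _ _ _ s0); apply: le_vol_radius.
by rewrite ler_pM2r// ltW.
Qed.

(** By doubling, one null ball makes all concentric balls null, hence the
    whole space, as [d] is finite. *)
Lemma vol_gt0 x s : (0 < s)%R -> (0 < vol x s)%R.
Proof.
move=> s0; rewrite lt_neqAle fine_ge0// andbT eq_sym; apply/eqP => v0.
apply: mu_neq0; apply: measure_negligible => //.
rewrite (_ : setT = \bigcup_n dball d x (2 ^+ n * s)%R).
  apply: negligible_bigcup => n; apply/negligibleP => //.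
  apply: etrans (volE _ _) _; congr (_%:E).
  apply/eqP; rewrite eq_le fine_ge0// andbT.
  by rewrite (le_trans (vol_expn n x s s0))// v0 mulr0.
apply/esym; rewrite -subTset => z _.
exists (Num.Def.archi_bound (d x z / s)) => //.
by rewrite /dball/= -ler_pdivrMr// ltW// upper_nthrootP.
Qed.

(** If the ball of radius [R0] had no finite [r]-net, it would contain
    [r]-separated sequences of any length.  The balls of radius
    [r / (2 kappa)] about their terms are disjoint, lie in one fixed ball, and
    by doubling have measure at least a fixed [e > 0]. *)
Lemma finite_net x0 (R0 r : R) : (0 < R0)%R -> (0 < r)%R ->
  exists s : seq T,
    forall z, dball d x0 R0 z -> exists2 c, c \in s & dball d c r z.
Proof.
move=> R00 r0; apply: contrapT => /forallNP nonet.
have sep (s : seq T) :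
    exists2 z, dball d x0 R0 z & forall c, c \in s -> (r < d c z)%R.
  have /existsNP[z /not_implyP[z1 z2]] := nonet s.
  exists z => // c cs; rewrite ltNge; apply/negP => h; apply: z2.
  by exists c.
pose r' := (r / (2 * kappa))%R.
have r'0 : (0 < r')%R by rewrite divr_gt0// mulr_gt0.
pose n0 := Num.Def.archi_bound (2 * kappa * R0 / r')%R.
pose e := (vol x0 R0 / C ^+ n0)%R.
have e0 : (0 < e)%R by rewrite divr_gt0 ?vol_gt0// exprn_gt0.
have ball_e z : dball d x0 R0 z -> (e <= vol z r')%R.
  move=> xz; rewrite ler_pdivrMr ?exprn_gt0// mulrC.
  apply: le_trans (vol_expn _ _ _ r'0); apply: le_vol.
  apply: (dball_sub _ _ qd); apply: (@le_trans _ _ (2 * kappa * R0)%R).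
    rewrite (mulrC 2%R) -mulrA ler_pM2l// mulr_natl mulr2n lerD2r.
    by rewrite (qm_sym _ _ qd).
  by rewrite -ler_pdivrMr// ltW// upper_nthrootP.
pose U (s : seq T) := \big[setU/set0]_(c <- s) dball d c r'.
have mU s : measurable (U s) by apply: bigsetU_measurable.
have big n : exists2 s : seq T,
    U s `<=` dball d x0 (kappa * (R0 + r'))%R & (n%:R * e)%:E <= mu (U s).
  elim: n => [|n [s sU IH]].
    by exists [::]; rewrite /U ?big_nil// mul0r.
  have [z xz zs] := sep s.
  exists (z :: s); rewrite /U big_cons.
    rewrite subUset; split => //; apply: (dball_sub _ _ qd).
    by rewrite ler_pM2l// lerD2r.
  have ez : e%:E <= mu (dball d z r') by rewrite volE lee_fin ball_e.
  rewrite measureU//.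
  - by rewrite -natr1 mulrDl mul1r addrC EFinD; exact: leeD.
  - exact: mU.
  rewrite -subset0 => y [zy]; rewrite -bigcup_seq => -[c /= cs cy].
  have := zs c cs; rewrite ltNge => /negP; apply.
  apply: (le_trans (qm_tri _ _ qd c z y)).
  have -> : (r = kappa * (r' + r'))%R by rewrite /r'; field; rewrite gt_eqF.
  by rewrite ler_pM2l//; apply: lerD => //; rewrite (qm_sym _ _ qd).
have [s sU] := big (Num.Def.archi_bound (vol x0 (kappa * (R0 + r')) / e))%R.
apply/negP; rewrite -ltNge.
apply: (@le_lt_trans _ _ (mu (dball d x0 (kappa * (R0 + r'))%R))).
  by apply: le_measure; rewrite ?inE.
rewrite volE lte_fin -ltr_pdivrMr//; apply: archi_boundP.
by rewrite divr_ge0 ?fine_ge0// ltW.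
Qed.

(* Passing to rectangles multiplies distances by at most L. *)
Let L : R := (kappa * (1 + 2 * kappa))%R.

Lemma rectangle_cover x0 (R0 r : R) : (0 < R0)%R -> (0 < r)%R ->
  exists G : set (T * T), [/\ measurable G,
   forall z y, dball d x0 R0 z -> (d z y <= r)%R -> G (z, y) &
   forall z y, G (z, y) -> (d z y <= L * r)%R].
Proof.
move=> R00 r0; have [s sP] := finite_net x0 R0 r R00 r0.
exists (\big[setU/set0]_(c <- s)
  (dball d c r `*` dball d c (2 * kappa * r)%R)); split.
- by apply: bigsetU_measurable => c _; exact: measurableX.
- move=> z y xz zy; rewrite -bigcup_seq; have [c cs cz] := sP z xz.
  exists c => //; split => //=; apply: (le_trans (qm_tri _ _ qd c y z)).
  rewrite (mulrC 2%R) -mulrA ler_pM2l// mulr_natl mulr2n.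
  exact: lerD.
- move=> z y; rewrite -bigcup_seq => -[c /= _ [/= cz cy]].
  apply: (le_trans (qm_tri _ _ qd z y c)).
  rewrite /L -mulrA ler_pM2l// mulrDl mul1r.
  by apply: lerD => //; rewrite (qm_sym _ _ qd).
Qed.

Lemma dyadic_pow n : ((2^-1 ^+ n) `^ (1 + delta) =
  2^-1 ^+ n * ((2^-1 : R) `^ delta) ^+ n)%R.
Proof.
have h0 : (0 < (2^-1 : R) ^+ n)%R by rewrite exprn_gt0.
rewrite powRD ?(gt_eqF h0) ?implybT// powRr1 ?(ltW h0)//; congr (_ * _)%R.
rewrite -[in LHS]powR_mulrn// -[in RHS]powR_mulrn ?powR_ge0//.
by rewrite -!powRrM mulrC.
Qed.

Let t : R := ((2^-1 : R) `^ delta)%R.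

Lemma dyadic_ratio : (0 < t < 1)%R.
Proof.
rewrite powR_gt0//=; have <- : ((1 : R) `^ delta = 1)%R by rewrite powR1.
apply: gt0_ltr_powR; rewrite ?nnegrE//.
by rewrite invf_lt1// ltr1n.
Qed.

Lemma geometric_nneseries_le (c : R) : (0 <= c)%R ->
  \sum_(0 <= k <oo) (c * t ^+ k.+1)%:E <= (c * (t / (1 - t)))%:E.
Proof.
move=> c0; have /andP[t0 t1] := dyadic_ratio.
have u0 k : 0 <= (c * t ^+ k.+1)%:E.
  by rewrite lee_fin mulr_ge0// exprn_ge0// ltW.
apply: lime_le; first by apply: is_cvg_nneseries => k _ _.
near=> n; rewrite sumEFin lee_fin -mulr_sumr ler_wpM2l//.
have -> : (\sum_(0 <= i < n) t ^+ i.+1 = t * series (geometric 1 t) n)%R.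
  by rewrite /series/= mulr_sumr; apply: eq_bigr => i _; rewrite mul1r exprS.
rewrite geometric_seriesE ?lt_eqF//= mul1r ler_pM2l// -[leRHS]mul1r.
rewrite ler_pM2r ?invr_gt0 ?subr_gt0//.
by rewrite gerBl exprn_ge0// ltW.
Unshelve. all: by end_near.
Qed.

(** With [G k] between [d z y <= D/2^k] and [d z y <= L D/2^k], the majorant is
    [sum_k (2^(k+1)/D) 1_(G k)].  It dominates the kernel because [2^(k+1)/D]
    bounds it outside [d z y <= D/2^(k+1)].  Its average is geometric because
    [mu] of the section of [G k] decays like [2^(-k(1 + delta))], faster than
    the coefficient [2^(k+1)/D] grows. *)
Lemma kernel_majorant x0 (R0 D : R) : (0 < R0)%R -> (0 < D)%R ->
  exists Kt : T * T -> \bar R, [/\ measurable_fun setT Kt, forall z, 0 <= Kt z,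
    forall z y, dball d x0 R0 z -> (d z y <= D)%R ->
      qkernel d z y <= Kt (z, y) &
    forall y, \int[mu]_z Kt (z, y) <=
      (C * (t / (1 - t)) / D * vol y (2 * (L * D)))%:E].
Proof.
move=> R00 D0; have /andP[t0 t1] := dyadic_ratio.
have L0 : (0 < L)%R by rewrite mulr_gt0// addr_gt0// mulr_gt0.
pose r k : R := (2^-1 ^+ k * D)%R.
have r0 k : (0 < r k)%R by rewrite mulr_gt0// exprn_gt0.
have [G GP] := choice (fun k => rectangle_cover x0 R0 (r k) R00 (r0 k)).
pose u k (z : T * T) := ((r k.+1)^-1%R%:E * (\1_(G k) z)%:E).
have u0 k z : 0 <= u k z by rewrite mule_ge0// lee_fin// invr_ge0 ltW.
have mG k : measurable (G k) by case: (GP k).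
have mu_ k : measurable_fun setT (u k).
  by apply: measurable_funeM; apply/measurable_EFinP; exact: measurable_indic.
exists (fun z => \sum_(0 <= k <oo) u k z); split.
- exact: ge0_emeasurable_sum.
- by move=> z; exact: nneseries_ge0.
- move=> z y xz zy.
  (* For a real v below the kernel, take the first k with v <= 2^(k+1)/D:
     minimality of k gives d z y <= D/2^k, and the k-th term is at least v.
     This covers d z y = 0, where v is arbitrary. *)
  have key (v : R) : (0 < v)%R -> v%:E <= qkernel d z y ->
      v%:E <= \sum_(0 <= k <oo) u k (z, y).
    move=> v0 vK.
    have exk : exists k, (v <= (r k.+1)^-1)%R.
      exists (Num.Def.archi_bound (v * D)%R).
      rewrite /r invfM exprVn invrK -ler_pdivrMr ?invr_gt0// invrK.
      by rewrite ltW// upper_nthrootP.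
    have [k vk kmin] := ex_minnP exk.
    have zyk : (d z y <= r k)%R.
      case: k vk kmin => [|k] _ kmin; first by rewrite /r expr0 mul1r.
      rewrite leNgt; apply/negP => rk.
      have : (r k.+1)^-1%R%:E < v%:E.
        by rewrite lte_fin ltNge; apply/negP => /kmin; rewrite ltnn.
      rewrite ltNge => /negP; apply; apply: (le_trans vK).
      by apply: (ge_qkernel _ _ qd) => //; exact: ltW.
    have Gk : G k (z, y) by have [_ h _] := GP k; exact: h.
    apply: (@le_trans _ _ (\sum_(0 <= i < k.+1) u i (z, y))).
      rewrite big_nat_recr//= -[leLHS]add0e; apply: leeD.
        exact: sume_ge0.
      by rewrite /u indicE mem_set// mule1 lee_fin.
    exact: nneseries_lim_ge.
  have [K0|Kp] := leP (qkernel d z y) 0.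
    by apply: (le_trans K0); exact: nneseries_ge0.
  move: Kp key; case: (qkernel d z y) => [v| |] //.
    by rewrite lte_fin => v0 /(_ _ v0 (lexx _)).
  move=> _ h; rewrite leye_eq; apply/eqP; apply: eq_infty => v.
  apply: (@le_trans _ _ (Num.max 1 v)%:E).
    by rewrite lee_fin le_max lexx orbT.
  by apply: h; rewrite ?leey// lt_max ltr01.
- move=> y; rewrite integral_nneseries//; last first.
    by move=> k; apply: (measurableT_comp (mu_ k)); exact: pair2_measurable.
  have -> : (C * (t / (1 - t)) / D * vol y (2 * (L * D)) =
      (C / D * vol y (2 * (L * D))) * (t / (1 - t)))%R.
    by field; rewrite ?gt_eqF// subr_gt0.
  apply: le_trans (geometric_nneseries_le _ _); last first.
    by rewrite mulr_ge0 ?fine_ge0// divr_ge0 ?ltW.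
  apply: lee_nneseries => [k _ _|k _]; first exact: integral_ge0.
  have mi : measurable_fun setT (fun z => (\1_(G k) (z, y))%:E : \bar R).
    apply/measurable_EFinP.
    apply: (measurableT_comp (measurable_indic (mG k))).
    exact: pair2_measurable.
  rewrite ge0_integralZl// ?lee_fin ?invr_ge0 ?(ltW (r0 _))//.
  have LD0 : (0 < 2 * (L * D))%R by apply: mulr_gt0 => //; exact: mulr_gt0.
  have le1 : \int[mu]_z (\1_(G k) (z, y))%:E <= mu (dball d y (L * r k)%R).
    rewrite -[dball d y (L * r k)%R]setIT -integral_indic//.
    apply: ge0_le_integral => //.
      by apply/measurable_EFinP; exact: measurable_indic.
    move=> z _; rewrite lee_fin !indicE ler_nat.
    case: (boolP ((z, y) \in G k)) => //; rewrite inE => Gz.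
    rewrite mem_set// /dball/= (qm_sym _ _ qd).
    by have [_ _] := GP k; apply.
  have rr : (L * r k = (2^-1 ^+ k.+1) * (2 * (L * D)))%R.
    by rewrite /r exprS; field.
  have le2 : mu (dball d y (L * r k)%R) <=
      (C * (2^-1 ^+ k.+1 * t ^+ k.+1) * vol y (2 * (L * D)))%:E.
    (* comparing with radius 2LD instead of LD keeps the inequality of radii
       strict when k = 0 *)
    have h := mu_dec y (L * r k)%R (2 * (L * D))%R.
    have e : (L * r k / (2 * (L * D)) = 2^-1 ^+ k.+1)%R.
      by rewrite rr mulfK// gt_eqF.
    rewrite EFinM -volE -dyadic_pow -e; apply: h.
      exact: (mulr_gt0 L0 (r0 k)).
    rewrite rr gtr_pMl//.
    by rewrite exprn_ilt1// ?invr_ge0// invf_lt1// ltr1n.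
  have rk0 : (0 <= (r k.+1)^-1%R)%R by rewrite invr_ge0 ltW.
  apply: (le_trans (lee_wpmul2l _ (le_trans le1 le2))).
    by rewrite lee_fin.
  rewrite -EFinM lee_fin le_eqVlt; apply/orP; left; apply/eqP.
  by rewrite /r; field; rewrite ?gt_eqF.
Qed.

(** * Averaging over a ball *)

(** Integrate [1 <= K g] over the ball [B].  The points [y] with
    [d x0 y > 2 kappa a] have [K z y <= 2 kappa w y] for all [z] in [B]; for
    the others the kernel is replaced by its majorant before the integrals are
    exchanged, and the average of the majorant is at most a constant times
    [mu(B)/a], while [1/a <= 2 kappa w y] there. *)
Lemma averaging (sigma : {sigma_finite_measure set T -> \bar R}) :
  exists2 A : R, (0 < A)%R & forall x0 a (g : T -> \bar R), (0 < a)%R ->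
    measurable_fun setT g -> (forall y, 0 <= g y) ->
    {ae mu, forall z, dball d x0 a z ->
      1 <= \int[sigma]_y (qkernel d z y * g y)} ->
    1 <= A%:E * \int[sigma]_y (g y * ((Num.max a (d x0 y))^-1)%R%:E).
Proof.
have /andP[t0 t1] := dyadic_ratio.
have L0 : (0 < L)%R by rewrite mulr_gt0// addr_gt0// mulr_gt0.
(* The factor for which the ball of radius 2LD = 2LLa about a near point y is
   contained in the ball of radius (factor * a) about x0. *)
have [A2 A20 A2P] := vol_scale (kappa * (2 * kappa + 2 * (L * L)))%R.
pose c1 := (C * (t / (1 - t)))%R.
have c10 : (0 < c1)%R by rewrite mulr_gt0// divr_gt0// subr_gt0.
pose A := (c1 * A2 * (2 * kappa) / L + 2 * kappa)%R.
have kk0 : (0 < 2 * kappa)%R by rewrite mulr_gt0.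
have b0 : (0 < c1 * A2 / L)%R by exact: divr_gt0 (mulr_gt0 c10 A20) L0.
have b1 : (0 < c1 * A2 * (2 * kappa) / L)%R.
  exact: divr_gt0 (mulr_gt0 (mulr_gt0 c10 A20) kk0) L0.
have A0 : (0 < A)%R by exact: addr_gt0.
exists A => // x0 a g a0 mg g0 gK.
pose B := dball d x0 a; pose near := dball d x0 (2 * kappa * a)%R.
have a2k : (a <= 2 * kappa * a)%R.
  rewrite -[leLHS]mul1r ler_pM2r// (le_trans k1)//.
  by rewrite ler_peMl ?(ltW k0)// ler1n.
(* D bounds the distance between a point of B and a near point. *)
pose D := (L * a)%R; have D0 : (0 < D)%R by exact: mulr_gt0.
have [Kt [mKt Kt0 KKt intKt]] := kernel_majorant x0 a D a0 D0.
pose w y := ((Num.max a (d x0 y))^-1)%R.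
have max0 y : (0 < Num.max a (d x0 y))%R by rewrite lt_max a0.
have w0 y : (0 <= w y)%R by rewrite invr_ge0 ltW.
have mw : measurable_fun setT w.
  apply: measurable_invr_ge0; first exact: measurable_max _ _ qd _ _.
  by move=> y; exact: ltW.
pose V := vol x0 a; have V0 : (0 < V)%R by exact: vol_gt0.
pose H (z : T * T) :=
  g z.2 * ((\1_near z.2)%:E * Kt z + (\1_B z.1 * (2 * kappa * w z.2))%:E).
have H0 z : 0 <= H z.
  apply: mule_ge0 => //; apply: adde_ge0.
    by apply: mule_ge0 => //; rewrite lee_fin.
  by rewrite lee_fin !mulr_ge0// ltW.
have mH : measurable_fun setT H.
  apply: emeasurable_funM.
    exact: (measurableT_comp mg (@measurable_snd _ _ _ _)).
  apply: emeasurable_funD.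
    apply: emeasurable_funM => //; apply/measurable_EFinP.
    exact: (measurableT_comp (measurable_indic (mB _ _))
      (@measurable_snd _ _ _ _)).
  apply/measurable_EFinP; apply: measurable_funM.
    exact: (measurableT_comp (measurable_indic (mB _ _))
      (@measurable_fst _ _ _ _)).
  apply: measurable_funM => //.
  exact: (measurableT_comp mw (@measurable_snd _ _ _ _)).
have step1 : V%:E <= \int[mu]_z \int[sigma]_y H (z, y).
  rewrite -volE -[dball d x0 a]setIT -integral_indic//.
  apply: ae_ge0_le_integral => //.
  - by apply/measurable_EFinP; exact: measurable_indic.
  - by move=> z _; exact: integral_ge0.
  - exact: (measurable_fun_fubini_tonelli_F H mH H0).
  apply: filterS gK => z zB _; rewrite indicE.
  case: (boolP (z \in dball d x0 a)) => [|_]; last exact: integral_ge0.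
  rewrite inE => xz; apply: (le_trans (zB xz)); apply: ge0_le_integral => //.
  - by move=> y _; apply: mule_ge0 => //; exact: qkernel_ge0 _ _ qd _ _.
  - by apply: emeasurable_funM => //; exact: measurable_qkernel _ _ qd _.
  - by apply: (measurableT_comp mH); exact: pair1_measurable.
  move=> y _; rewrite /H/= muleC; apply: lee_wpmul2l => //.
  have [yn|yn] := leP (d x0 y) (2 * kappa * a)%R.
    rewrite !indicE mem_set// mul1e.
    apply: (@le_trans _ _ (Kt (z, y))); last first.
      by rewrite leeDl// lee_fin !mulr_ge0// ltW.
    apply: KKt => //; apply: (le_trans (qm_tri _ _ qd z y x0)).
    rewrite /D /L -mulrA ler_pM2l// mulrDl mul1r; apply: lerD => //.
    by rewrite (qm_sym _ _ qd).
  rewrite -[leLHS]add0e; apply: leeD.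
    by apply: mule_ge0 => //; rewrite lee_fin.
  rewrite indicE mem_set// mul1r.
  have ady : (a <= d x0 y)%R by exact: ltW (le_lt_trans a2k yn).
  have d00 : (0 < d x0 y)%R by apply: lt_le_trans ady.
  have -> : (2 * kappa * w y = (d x0 y / (2 * kappa))^-1)%R.
    by rewrite /w max_r// invf_div.
  apply: (ge_qkernel _ _ qd); first exact: divr_gt0.
  rewrite ler_pdivrMr//.
  have h : (d x0 y <= kappa * (a + d z y))%R.
    apply: (le_trans (qm_tri _ _ qd x0 y z)).
    by rewrite ler_pM2l// lerD2r.
  lra.
have step2 : \int[mu]_z \int[sigma]_y H (z, y) <=
    \int[sigma]_y (g y * (A * V * w y)%:E).
  rewrite (fubini_tonelli H mH H0); apply: ge0_le_integral => //.
  - by move=> y _; exact: integral_ge0.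
  - exact: (measurable_fun_fubini_tonelli_G H mH H0).
  - apply: emeasurable_funM => //; apply/measurable_EFinP.
    exact: measurable_funM.
  move=> y _; rewrite /H/=.
  have mKty : measurable_fun setT (fun z => (\1_near y)%:E * Kt (z, y)).
    apply: measurable_funeM; apply: (measurableT_comp mKt).
    exact: pair2_measurable.
  have mB1 : measurable_fun setT (fun z => (\1_B z)%:E : \bar R).
    by apply/measurable_EFinP; exact: (measurable_indic (mB _ _)).
  have mBw : measurable_fun setT
      (fun z => (\1_B z * (2 * kappa * w y))%:E : \bar R).
    apply/measurable_EFinP; apply: measurable_funM; last by [].
    exact: (measurable_indic (mB _ _)).
  have Kty0 z : 0 <= (\1_near y)%:E * Kt (z, y).
    by apply: mule_ge0 => //; rewrite lee_fin.
  have Bw0 z : 0 <= (\1_B z * (2 * kappa * w y))%:E.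
    by rewrite lee_fin !mulr_ge0// ltW.
  rewrite ge0_integralZl//; last 2 first.
  - exact: emeasurable_funD.
  - by move=> z _; exact: adde_ge0.
  apply: lee_wpmul2l => //; rewrite ge0_integralD//.
  have -> : (A * V * w y =
      c1 * A2 * (2 * kappa) / L * V * w y + 2 * kappa * w y * V)%R.
    by rewrite /A; ring.
  rewrite EFinD; apply: leeD; last first.
    under eq_integral do rewrite mulrC EFinM.
    rewrite (ge0_integralZl _ _ mB1)// ?lee_fin ?mulr_ge0 ?(ltW k0)//.
    rewrite integral_indic//; last exact: mB.
    by rewrite setIT [X in _ * X <= _](_ : _ = V%:E) -?EFinM//; exact: volE.
  rewrite indicE; case: (boolP (y \in near)) => [|_]; last first.
    rewrite integral0_eq => [|z _]; last by rewrite mul0e.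
    by rewrite lee_fin; apply: mulr_ge0 => //; exact: ltW (mulr_gt0 b1 V0).
  rewrite inE => yn; under eq_integral do rewrite mul1e.
  apply: (le_trans (intKt y)); rewrite lee_fin -/c1.
  have v1 : (vol y (2 * (L * D)) <= A2 * V)%R.
    apply: le_trans (A2P _ _ a0); apply: le_vol; apply: (dball_sub _ _ qd).
    rewrite [leRHS](_ : _ = kappa * (2 * kappa * a + 2 * (L * D)))%R.
      by rewrite ler_pM2l// lerD2r.
    by rewrite /D; ring.
  have w1 : (a^-1 <= 2 * kappa * w y)%R.
    rewrite -ler_pdivrMl// -invfM lef_pV2 ?posrE// ?mulr_gt0//.
    by rewrite ge_max yn andbT.
  apply: (@le_trans _ _ (c1 / D * (A2 * V))%R).
    by rewrite ler_wpM2l// divr_ge0 ?ltW.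
  have -> : (c1 / D * (A2 * V) = c1 * A2 / L * V * a^-1)%R.
    by rewrite /D; field; rewrite !gt_eqF.
  have -> : (c1 * A2 * (2 * kappa) / L * V * w y =
      c1 * A2 / L * V * (2 * kappa * w y))%R by ring.
  by rewrite ler_wpM2l//; exact: ltW (mulr_gt0 b0 V0).
have := le_trans step1 step2.
have -> : \int[sigma]_y (g y * (A * V * w y)%:E) =
    V%:E * (A%:E * \int[sigma]_y (g y * (w y)%:E)).
  rewrite muleA -EFinM -ge0_integralZl//.
  - by apply: eq_integral => y _; rewrite [in LHS]EFinM muleCA (mulrC V).
  - by apply: emeasurable_funM => //; exact/measurable_EFinP.
  - by move=> y _; apply: mule_ge0 => //; rewrite lee_fin.
  - by rewrite lee_fin; exact: ltW (mulr_gt0 V0 A0).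
by rewrite -[leLHS]mule1 lee_pmul2l// lte_fin.
Qed.

End stable_measure.

(** * Two-sided bounds on a quasi-metric measure space *)

Section capacity.
Context {disp} {T : measurableType disp} {R : realType}.
Context (d : T -> T -> R) (kappa : R) (qd : quasi_metric d kappa).
Context (sigma : {sigma_finite_measure set T -> \bar R}).
Context (p q : R) (p1 : (1 < p)%R) (pq : (p^-1 + q^-1 = 1)%R).

Let q0 : (0 < q)%R := conj_gt0 p q p1 pq.
Let s0 : (0 < p / q)%R. Proof. by rewrite divr_gt0// (lt_trans _ p1). Qed.

Lemma capacity_upper : exists2 C : R, (0 < C)%R &
  forall x a (I : \bar R), (0 < a)%R ->
  (forall g : T -> \bar R, measurable_fun setT g -> (forall y, 0 <= g y) ->
    (forall z, dball d x a z -> 1 <= \int[sigma]_y (qkernel d z y * g y)) ->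
    I <= \int[sigma]_y (g y `^ p)) ->
  I <= C%:E * (tail_int d sigma q x a `^ (p / q))^-1.
Proof.
have c0 : (0 < (2 * kappa) `^ p * (q `^ (p / q))^-1)%R.
  by rewrite mulr_gt0 ?invr_gt0 ?powR_gt0 ?mulr_gt0 ?(qm_k0 _ _ qd).
exists ((2 * kappa) `^ p * (q `^ (p / q))^-1)%R => // x a I a0 h.
apply: le_mul_inve_poweR => //; first exact: tail_int_ge0.
move=> M M0 MN.
have qM0 : (0 < q * M)%R by exact: mulr_gt0.
have qMW : (q * M)%:E <= \int[sigma]_y (qweight d q x a y)%:E.
  by rewrite (int_qweight _ _ qd)// EFinM lee_pmul2l// lte_fin.
have [g [mg g0 gK gI]] :=
  exists_test_function p q p1 pq _ _ _ _ _ _ qd a0 qM0 qMW.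
apply: (le_trans (h g mg g0 gK)); apply: (le_trans gI).
by rewrite lee_fin (powRM _ (ltW q0) (ltW M0)) invfM mulrA.
Qed.

Lemma energy_lower (mu : {sigma_finite_measure set T -> \bar R})
    (C delta : R) :
  (0 < C)%R -> (0 < delta)%R -> (forall x s, mu (dball d x s) < +oo) ->
  (forall x s, (0 < s)%R ->
    mu (dball d x (2 * s)%R) <= C%:E * mu (dball d x s)) ->
  (forall x r s, (0 < r)%R -> (r < s)%R ->
    mu (dball d x r) <=
      (C * (r / s) `^ (1 + delta))%R%:E * mu (dball d x s)) ->
  mu setT <> 0 ->
  exists2 c : R, (0 < c)%R & forall x a (g : T -> \bar R), (0 < a)%R ->
    measurable_fun setT g -> (forall y, 0 <= g y) ->
    {ae mu, forall z, dball d x a z ->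
      1 <= \int[sigma]_y (qkernel d z y * g y)} ->
    c%:E * (tail_int d sigma q x a `^ (p / q))^-1 <= \int[sigma]_y (g y `^ p).
Proof.
move=> C0 delta0 fin dbl dec nz.
have [A A0 AP] := averaging _ _ qd mu C delta C0 delta0 fin dbl dec nz sigma.
have p0 : (0 < p)%R by rewrite (lt_trans _ p1).
pose c0 := (p / (2 * A) * ((2 * A / q) `^ (p / q))^-1)%R.
have c00 : (0 < c0)%R.
  by rewrite mulr_gt0 ?invr_gt0 ?powR_gt0 ?divr_gt0 ?mulr_gt0.
have c10 : (0 < c0 * (q `^ (p / q))^-1)%R.
  by rewrite mulr_gt0 ?invr_gt0 ?powR_gt0.
exists (c0 * (q `^ (p / q))^-1)%R => // x a g a0 mg g0 gK.
have h := AP x a g a0 mg g0 gK.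
apply: ge_mul_inve_poweR => //; first exact: tail_int_ge0.
  by apply: integral_ge0 => y _; exact: poweR_ge0.
move=> M M0 NM.
have max0 y : (0 < Num.max a (d x y))%R by rewrite lt_max a0.
have w0 y : (0 <= (Num.max a (d x y))^-1)%R by rewrite invr_ge0 ltW.
have mw : measurable_fun setT (fun y => (Num.max a (d x y))^-1)%R.
  apply: measurable_invr_ge0; first exact: measurable_max _ _ qd _ _.
  by move=> y; exact: ltW.
have := energy_ge p q p1 pq sigma g _ A (q * M)%R mg g0 mw w0 A0
  (mulr_gt0 q0 M0) h.
rewrite -/c0 (powRM _ (ltW q0) (ltW M0)) invfM mulrA; apply.
rewrite EFinM (le_trans _ (lee_wpmul2l _ NM)) ?lee_fin ?(ltW q0)//.
rewrite -(int_qweight _ _ qd)// le_eqVlt; apply/orP; left; apply/eqP.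
apply: eq_integral => y _; congr (_%:E).
rewrite /qweight -[in LHS]powR_inv1 ?(ltW (max0 y))//.
by rewrite -powRrM mulN1r powRN.
Qed.

End capacity.

(** * Borel quasi-metric kernels on a metric space *)

Lemma borel_pair_measurable {R : realType} {X : pmetricType R} (x : X) :
  measurable_fun setT ((fun y : X => (x, y)) : borel X -> borel (X * X)%type).
Proof.
apply: (@measurability _ _ (borel X) (borel (X * X)%type) _ _
  (@open (X * X)%type)) => // _ [B oB <-].
rewrite setTI; apply: sub_sigma_algebra => /=.
by apply: open_comp oB => y _; apply: cvg_pair => //; exact: cvg_cst.
Qed.

Section borel_kernel.
Context {R : realType} {X : pmetricType R} (K : X -> X -> \bar R).
Context (hK : quasi_metric_kernel K).

Definition qdist (x y : borel X) : R := fine (rho K x y).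

Lemma rhoE x y : rho K x y = (qdist x y)%:E.
Proof.
rewrite /qdist fineK//; have [_ K0 _ _] := hK.
by rewrite fin_numV ?gt_eqF// (lt_trans _ (K0 x y)).
Qed.

Lemma KE x y : K x y = qkernel qdist x y.
Proof. by rewrite /qkernel -rhoE /rho inveK. Qed.

Lemma qdist_quasi_metric : exists kappa, quasi_metric qdist kappa.
Proof.
have [mK K0 KC [kappa k1 tri]] := hK; exists kappa; split=> //.
- by move=> x y; rewrite /qdist fine_ge0// inve_ge0 ltW.
- by move=> x y; rewrite /qdist /rho KC.
- by move=> x y z; rewrite -lee_fin EFinM EFinD -!rhoE.
move=> x.
(* When K x y = +oo both sides vanish, since fine +oo = 0 and 0^-1 = 0. *)
have -> : qdist x = fun y => ((fine (K x y))^-1)%R.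
  apply/funext => y; rewrite /qdist /rho; case: (K x y) (K0 x y) => [r| |]//=.
    by rewrite lte_fin => r0; rewrite inver gt_eqF.
  by rewrite ?invey/= invr0.
apply: measurable_invr_ge0; last by move=> y; rewrite fine_ge0// ltW.
have mKx := measurableT_comp mK (borel_pair_measurable x).
exact: (measurableT_comp (fine_measurable measurableT) mKx).
Qed.

Lemma qballE x a : qball K x a = dball qdist x a.
Proof. by apply/funext => y; rewrite /qball /dball/= rhoE lee_fin. Qed.

Lemma potentialE (sigma : {measure set (borel X) -> \bar R}) g x :
  potential K sigma g x = \int[sigma]_y (qkernel qdist x y * g y).
Proof. by apply: eq_integral => y _; rewrite KE. Qed.

Lemma NintE (sigma : {measure set (borel X) -> \bar R}) q x a :
  Nint K sigma q x a = tail_int qdist sigma q x a.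
Proof. by apply: eq_integral => t _; rewrite qballE. Qed.

Lemma locally_finite_dball (mu : {measure set (borel X) -> \bar R}) x s :
  locally_finite K mu -> mu (dball qdist x s) < +oo.
Proof.
have [kappa qd] := qdist_quasi_metric.
move=> /(_ (dball qdist x s) (measurable_dball _ _ qd x s)); apply.
apply: (@le_lt_trans _ _ (kappa * (s + s))%:E); last exact: ltry.
apply: ge_ereal_sup => _ [[y z] [/= xy xz] <-].
rewrite rhoE lee_fin (le_trans (qm_tri _ _ qd y z x))//.
rewrite ler_pM2l ?(qm_k0 _ _ qd)//.
by apply: lerD => //; rewrite (qm_sym _ _ qd).
Qed.

Lemma cap_le_Cap (sigma : {measure set (borel X) -> \bar R}) p E :
  cap K sigma p E <= Cap K sigma p E.
Proof.
apply: ereal_inf_le_tmp => _ [g [[mg g0] gE] <-]; exists g => //; split => //.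
apply: aeW => x; rewrite indicE.
case: (boolP (x \in E)) => [|_]; first by rewrite inE; exact: gE.
apply: integral_ge0 => y _; apply: mule_ge0 => //.
by have [_ K0 _ _] := hK; exact: ltW.
Qed.

Context (sigma : {sigma_finite_measure set (borel X) -> \bar R}).
Context (p q : R) (p1 : (1 < p)%R) (pq : (p^-1 + q^-1 = 1)%R).

Lemma Npow_ge0 x a : 0 <= Npow K sigma p q x a.
Proof. by rewrite inve_ge0 poweR_ge0. Qed.

Lemma Cap_qball_le : exists2 C : R, (0 < C)%R & forall x a, (0 < a)%R ->
  Cap K sigma p (qball K x a) <= C%:E * Npow K sigma p q x a.
Proof.
have [kappa qd] := qdist_quasi_metric.
have [C C0 CP] := capacity_upper _ _ qd sigma p q p1 pq.
exists C => // x a a0; rewrite /Npow NintE; apply: CP => // g mg g0 gK.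
apply: ereal_inf_lbound; exists g => //; split => // z.
by rewrite qballE potentialE; exact: gK.
Qed.

(** Asking for [1 <= K g] only [mu]-almost everywhere on the ball makes this
    apply to the test functions of both capacities. *)
Lemma Npow_le_energy (mu : {sigma_finite_measure set (borel X) -> \bar R}) :
  mu setT <> 0 -> stable K mu ->
  exists2 c : R, (0 < c)%R &
    forall x a (g : borel X -> \bar R), (0 < a)%R -> borel_ge0 g ->
    {ae mu, forall z, qball K x a z -> 1 <= potential K sigma g z} ->
    c%:E * Npow K sigma p q x a <= \int[sigma]_y (g y `^ p).
Proof.
have [kappa qd] := qdist_quasi_metric.
move=> nz [lf [C [delta [C0 delta0 st]]]].
have [||c c0 cP] := energy_lower _ _ qd sigma p q p1 pq mu C delta C0 delta0
  (fun x s => locally_finite_dball mu x s lf) _ _ nz.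
- move=> x s s0; rewrite -!qballE.
  have hs : (s / 2 < s)%R by rewrite gtr_pMr// invf_lt1// ltr1n.
  by have [] := st x (s / 2)%R s (divr_gt0 s0 (ltr0Sn _ 1)) hs.
- by move=> x r s r0 rs; rewrite -!qballE; have [] := st x r s r0 rs.
exists c => // x a g a0 [mg g0] gK; rewrite /Npow NintE; apply: cP => //.
by apply: ae_imply gK => z zK; rewrite -qballE -potentialE.
Qed.

End borel_kernel.

Theorem theorem5p4 (R : realType) (X : pmetricType R) (K : X -> X -> \bar R)
    (sigma : {sigma_finite_measure set (borel X) -> \bar R}) (p q : R)
    (hK : quasi_metric_kernel K) (hp : (1 < p)%R)
    (hpq : (p^-1 + q^-1 = 1)%R) :
  [/\ exists2 C : R, (0 < C)%R &
        forall (x : X) (a : R), (0 < a)%R ->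
          Cap K sigma p (qball K x a) <= C%:E * Npow K sigma p q x a,
      (exists mu : {sigma_finite_measure set (borel X) -> \bar R},
          mu [set: borel X] <> 0 /\ stable K mu) ->
      exists2 C : R, (0 < C)%R &
        forall (x : X) (a : R), (0 < a)%R ->
          (C^-1)%R%:E * Npow K sigma p q x a <= Cap K sigma p (qball K x a) /\
          Cap K sigma p (qball K x a) <= C%:E * Npow K sigma p q x a &
      (exists mu : {sigma_finite_measure set (borel X) -> \bar R},
          [/\ mu [set: borel X] <> 0, mu `<< sigma & stable K mu]) ->
      exists2 C : R, (0 < C)%R &
        forall (x : X) (a : R), (0 < a)%R ->
          [/\ (C^-1)%R%:E * Npow K sigma p q x a <= cap K sigma p (qball K x a),
              cap K sigma p (qball K x a) <= Cap K sigma p (qball K x a) &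
              Cap K sigma p (qball K x a) <= C%:E * Npow K sigma p q x a]].
Proof.
have [C1 C10 upper] := Cap_qball_le K hK sigma p q hp hpq.
have common c : (0 < c)%R -> exists2 C : R, (0 < C)%R &
    (forall x a, C1%:E * Npow K sigma p q x a <= C%:E * Npow K sigma p q x a) /\
    (forall x a,
      (C^-1)%R%:E * Npow K sigma p q x a <= c%:E * Npow K sigma p q x a).
  move=> c0; exists (Num.max C1 c^-1)%R; first by rewrite lt_max C10.
  split=> x a; apply: lee_wpmul2r;
    rewrite ?Npow_ge0// lee_fin ?le_max ?lexx//.
  rewrite -[leRHS]invrK lef_pV2 ?posrE ?lt_max ?C10 ?invr_gt0//.
  by rewrite le_max lexx orbT.
split; first by exists C1.
- move=> [mu [nz st]].
  have [c c0 lower] := Npow_le_energy K hK sigma p q hp hpq mu nz st.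
  have [C C0 [CP1 CP2]] := common c c0; exists C => // x a a0; split.
    apply: (le_trans (CP2 x a)); apply/ereal_infP => _ [g [bg gE] <-].
    by apply: lower => //; exact: aeW.
  exact: le_trans (upper x a a0) (CP1 x a).
- move=> [mu [nz dom st]].
  have [c c0 lower] := Npow_le_energy K hK sigma p q hp hpq mu nz st.
  have [C C0 [CP1 CP2]] := common c c0; exists C => // x a a0; split.
  + apply: (le_trans (CP2 x a)); apply/ereal_infP => _ [g [bg gE] <-].
    apply: lower => //; apply: (ae_dominates mu sigma) => //.
    by apply: ae_imply gE => z gz xz; move: gz; rewrite indicE mem_set.
  + exact: cap_le_Cap.
  + exact: le_trans (upper x a a0) (CP1 x a).
Qed.
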